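(* Consider the $2$-user linear deterministic Z interference channel with parameters $(m,n)$, with unidirectional transmitter cooperation of rate $C$ from transmitter $2$ to transmitter $1$ and with the secrecy constraint at receiver $1$. Let $\alpha=n/m$ and suppose $1<\alpha<2$ (high interference regime). Then every rate pair $(R_1,R_2)$ in the secrecy capacity region satisfies $$R_1\le m,\qquad R_2\le 2m-n,\qquad R_1+R_2\le m+C.$$
   Context: Linear deterministic Z interference channel: let $m\ge 1$, $n\ge 0$ be integers and $q=\max\{m,n\}$. In each channel use, transmitter $1$ sends a binary vector $\mathbf{x}_1$ of length $m$ and transmitter $2$ sends a binary vector $\mathbf{x}_2$ of length $q$ (a vector shorter than $q$ is regarded as occupying the top entries of a length-$q$ vector, the remaining entries being $0$). The outputs are $$\mathbf{y}_1=\mathbf{D}^{q-m}\mathbf{x}_1\oplus\mathbf{D}^{q-n}\mathbf{x}_2,\qquad \mathbf{y}_2=\mathbf{D}^{q-m}\mathbf{x}_2,$$ where $\oplus$ is entrywise addition modulo $2$ and $\mathbf{D}$ is the $q\times q$ downshift matrix with entries $d_{j',j''}=1$ if $2\le j'=j''+1\le q$ and $0$ otherwise. Thus receiver $2$ observes the top $m$ bits of $\mathbf{x}_2$, and receiver $1$ observes the modulo-$2$ sum of the top $m$ bits of $\mathbf{x}_1$ and the top $n$ bits of $\mathbf{x}_2$, aligned at the bottom. The channel is used $N$ times without memory; $\mathbf{x}_i^N,\mathbf{y}_i^N$ denote the blocks of $N$ inputs and outputs. Messages and encoding: $W_1,W_2$ are independent and uniformly distributed, $W_i$ on a set of size $2^{NR_i}$.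 A noiseless and secure cooperative link of rate $C\ge 0$ bits per channel use (an integer) goes from transmitter $2$ to transmitter $1$; the signal sent on it during the block is $\mathbf{v}_{21}^N$, with $H(\mathbf{v}_{21}^N)\le NC$. The signals $\mathbf{x}_2^N$ and $\mathbf{v}_{21}^N$ are functions of $W_2$ and possibly local randomness at transmitter $2$, so they are independent of $W_1$. The input of transmitter $1$ is a function of $W_1$, of the cooperative signal received so far (causality: it may not depend on cooperative signals sent in the future), and possibly of local randomness (artificial noise). The local randomness at the two transmitters is independent of each other and of the messages. In particular, $(W_1,\mathbf{x}_1^N)\to\mathbf{v}_{21}^N\to(W_2,\mathbf{x}_2^N)$ is a Markov chain. Secrecy capacity region: $(R_1,R_2)$ is achievable if there is a sequence of such codes with $N\to\infty$ for which receiver $i$ decodes $W_i$ from $\mathbf{y}_i^N$ with error probability tending to $0$ ($i=1,2$) and weak secrecy holds: $\frac1N I(W_2;\mathbf{y}_1^N)\to 0$. (Secrecy of $W_1$ at receiver $2$ is automatic, since transmitter $1$ is not connected to receiver $2$.) The secrecy capacity region is the closure of the set of achievable pairs. Entropies and mutual informations are in bits. *)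

(* Defs.v *)
From HB Require Import structures.
From mathcomp Require Import all_boot all_order all_algebra.
From mathcomp Require Import all_classical all_reals all_analysis.

Set Implicit Arguments.
Unset Strict Implicit.
Unset Printing Implicit Defensive.

Import Order.TTheory GRing.Theory Num.Theory.
Import numFieldNormedType.Exports.

Local Open Scope classical_set_scope.
Local Open Scope ring_scope.

Section Information.
Context {d : measure_display} {T : measurableType d} {R : realType}.
Variable P : probability T R.

(* A random variable with values in a finite type, which carries no canonical
   sigma-algebra: for the discrete one, measurability reduces to singletons. *)
Definition finite_rv (A : finType) (X : T -> A) : Prop :=
  forall a, measurable (X @^-1` [set a]).

Definition pr (E : set T) : R := fine (P E).

Definition mass (A : finType) (X : T -> A) (a : A) : R := pr (X @^-1` [set a]).

Definition log2 (x : R) : R := ln x / ln 2.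

(* In bits; terms of probability 0 vanish. *)
Definition entropy (A : finType) (X : T -> A) : R :=
  - \sum_(a : A) mass X a * log2 (mass X a).

Definition mutual_info (A B : finType) (X : T -> A) (Y : T -> B) : R :=
  \sum_(a : A) \sum_(b : B)
    mass (fun w => (X w, Y w)) (a, b) *
    log2 (mass (fun w => (X w, Y w)) (a, b) / (mass X a * mass Y b)).

Definition uniform_rv (A : finType) (X : T -> A) : Prop :=
  forall a, mass X a = (#|A|%:R)^-1.

(* Mutual independence of two finite random variables X1, X2 and two random
   variables Y1, Y2 with values in measurable spaces; the product rule for
   subfamilies is the case where some of the sets are full. *)
Definition independent4 (A1 A2 : finType)
    (d1 d2 : measure_display) (S1 : measurableType d1) (S2 : measurableType d2)
    (X1 : T -> A1) (X2 : T -> A2) (Y1 : T -> S1) (Y2 : T -> S2) : Prop :=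
  forall (E1 : set A1) (E2 : set A2) (F1 : set S1) (F2 : set S2),
    measurable F1 -> measurable F2 ->
    pr (X1 @^-1` E1 `&` X2 @^-1` E2 `&` Y1 @^-1` F1 `&` Y2 @^-1` F2) =
    pr (X1 @^-1` E1) * pr (X2 @^-1` E2) * pr (Y1 @^-1` F1) * pr (Y2 @^-1` F2).

End Information.

Section Channel.
Variables m n : nat.
Let q := maxn m n.

(* Row 0 is the top (most significant) entry of a vector. *)
Definition downshift (k : nat) : 'M['F_2]_k :=
  \matrix_(i < k, j < k) (i == j.+1 :> nat)%:R.

Definition zero_pad (k l : nat) (x : 'cV['F_2]_k) : 'cV['F_2]_l :=
  \col_(i < l) (if insub (i : nat) is Some j then x j 0 else 0).

Definition zic_output1 (x1 : 'cV['F_2]_m) (x2 : 'cV['F_2]_q) : 'cV['F_2]_q :=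
  downshift q ^+ (q - m) *m zero_pad q x1 + downshift q ^+ (q - n) *m x2.

Definition zic_output2 (x2 : 'cV['F_2]_q) : 'cV['F_2]_q :=
  downshift q ^+ (q - m) *m x2.

End Channel.

Definition block (N : nat) (A : finType) : finType := {ffun 'I_N -> A}.

(* Stochastic codes of block length N with M1, M2 messages. All encoders are
   deterministic functions of a message, the cooperative signal and the local
   randomness U1, U2, which may take values in arbitrary measurable spaces. *)
Record zic_code (R : realType) (m n C N M1 M2 : nat) := ZICCode {
  disp : measure_display;
  Omega : measurableType disp;
  prob : probability Omega R;
  disp1 : measure_display;
  rnd1 : measurableType disp1;
  disp2 : measure_display;
  rnd2 : measurableType disp2;
  W1 : Omega -> 'I_M1;
  W2 : Omega -> 'I_M2;
  U1 : {RV prob >-> rnd1};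
  U2 : {RV prob >-> rnd2};
  coop_alphabet : finType;
  coop : 'I_M2 -> rnd2 -> block N coop_alphabet;
  enc1 : 'I_M1 -> block N coop_alphabet -> rnd1 -> block N 'cV['F_2]_m;
  enc2 : 'I_M2 -> rnd2 -> block N 'cV['F_2]_(maxn m n);
  dec1 : block N 'cV['F_2]_(maxn m n) -> 'I_M1;
  dec2 : block N 'cV['F_2]_(maxn m n) -> 'I_M2;
  W1_rv : finite_rv W1;
  W2_rv : finite_rv W2;
  W1_uniform : uniform_rv prob W1;
  W2_uniform : uniform_rv prob W2;
  sources_independent : independent4 prob W1 W2 U1 U2;
  coop_measurable : forall w, finite_rv (coop w);
  enc1_measurable : forall w v, finite_rv (enc1 w v);
  enc2_measurable : forall w, finite_rv (enc2 w);
  (* Causality: at time t only the cooperative signals of times s <= t matter. *)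
  enc1_causal : forall w u (t : 'I_N) (v v' : block N coop_alphabet),
    (forall s : 'I_N, (s <= t)%N -> v s = v' s) ->
    enc1 w v u t = enc1 w v' u t;
  coop_rate :
    entropy prob (fun o => coop (W2 o) (U2 o)) <= N%:R * C%:R
}.

Section CodePerformance.
Variables (R : realType) (m n C N M1 M2 : nat) (c : zic_code R m n C N M1 M2).

Definition v21 (o : Omega c) : block N (coop_alphabet c) :=
  coop (W2 o) (U2 c o).

Definition x1 (o : Omega c) : block N 'cV['F_2]_m :=
  enc1 (W1 o) (v21 o) (U1 c o).

Definition x2 (o : Omega c) : block N 'cV['F_2]_(maxn m n) :=
  enc2 (W2 o) (U2 c o).

Definition y1 (o : Omega c) : block N 'cV['F_2]_(maxn m n) :=
  [ffun t => zic_output1 (x1 o t) (x2 o t)].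

Definition y2 (o : Omega c) : block N 'cV['F_2]_(maxn m n) :=
  [ffun t => zic_output2 (x2 o t)].

Definition error1 : R := pr (prob c) [set o | dec1 c (y1 o) <> W1 o].

Definition error2 : R := pr (prob c) [set o | dec2 c (y2 o) <> W2 o].

Definition leakage : R :=
  N%:R^-1 * mutual_info (prob c) (fun o : Omega c => W2 o) y1.

End CodePerformance.

(* 2^(N r), rounded up to an integer. *)
Definition message_count (R : realType) (N : nat) (r : R) : nat :=
  `|Num.ceil (2 `^ (N%:R * r))|%N.

Definition achievable (R : realType) (m n C : nat) (r : R * R) : Prop :=
  [/\ 0 <= r.1, 0 <= r.2 &
  exists (N : nat -> nat)
         (c : forall k, zic_code R m n C (N k)
                (message_count (N k) r.1) (message_count (N k) r.2)),
  [/\ N @ \oo --> \oo,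
      (fun k => error1 (c k)) @ \oo --> (0 : R),
      (fun k => error2 (c k)) @ \oo --> (0 : R) &
      (fun k => leakage (c k)) @ \oo --> (0 : R)]].

Definition secrecy_capacity_region (R : realType) (m n C : nat) :
    set (R * R) :=
  closure [set r | achievable m n C r].

(* Main.v *)
(* Write T for the top n - m entries of x2, which both receivers see in the clear,
   and let all entropies be those of a single code of length N.

   Rate R1: H(y1) <= H(T) + N m, while W1 is independent of x2 and, given
   (W1, v21), x1 is independent of x2, so H(y1 | W1) >= H(T) + H(x1 | W1, v21).
   Hence I(W1; y1) <= N m - H(x1 | W1, v21).

   Rate R2: I(W2; y2) <= I(W2; T) + N (2 m - n), and secrecy makes I(W2; T) small.

   Sum rate: receiver 1 decodes W1, so I(W2; y1, W1) is also small. Revealing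
   (v21, x2, y1, W1) to receiver 2 then costs at most
   H(v21) + H(x2 | y1, W1, v21) <= N C + H(x1 | W1, v21), since y1 and x1 determine
   x2; the last term cancels against the bound for R1. *)

Require Import Defs.
From mathcomp Require Import all_boot all_order all_algebra.
From mathcomp Require Import all_classical all_reals all_analysis.
From mathcomp Require Import ring lra zify.
Import Order.TTheory GRing.Theory Num.Theory.
Import numFieldNormedType.Exports.
Local Open Scope classical_set_scope.
Local Open Scope ring_scope.

(** * Base-2 logarithm *)

Section Log2.
Context {R : realType}.
Implicit Types x y : R.

Lemma ln2_gt0 : 0 < ln 2 :> R.
Proof. by rewrite ln_gt0 // ltr1n. Qed.

Lemma log2M x y : 0 < x -> 0 < y -> log2 (x * y) = log2 x + log2 y.
Proof. by move=> x0 y0; rewrite /log2 lnM ?posrE // mulrDl. Qed.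

Lemma log2V x : 0 < x -> log2 x^-1 = - log2 x.
Proof. by move=> x0; rewrite /log2 lnV ?posrE // mulNr. Qed.

Lemma log2_2 : log2 2 = 1 :> R.
Proof. by rewrite /log2 divff // gt_eqF // ln2_gt0. Qed.

Lemma log2X x k : 0 < x -> log2 (x ^+ k) = k%:R * log2 x.
Proof. by move=> x0; rewrite /log2 lnXn // -[ln x *+ k]mulr_natl mulrA. Qed.

Lemma ler_log2 x y : 0 < x -> x <= y -> log2 x <= log2 y.
Proof.
move=> x0 xy; rewrite /log2 ler_pM2r ?invr_gt0 ?ln2_gt0 // ler_ln ?posrE //.
exact: lt_le_trans xy.
Qed.

Lemma log2_le_sub1 x : 0 < x -> log2 x <= (x - 1) / ln 2.
Proof.
move=> x0; rewrite /log2 ler_pM2r ?invr_gt0 ?ln2_gt0 //.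
have := expR_ge1Dx (ln x); rewrite lnK ?posrE // => h; lra.
Qed.

End Log2.

(** Functional dependence without naming the function: all structural facts about the channel enter
    the entropy inequalities in this form. *)
Definition determines {A B C : Type} (f : A -> B) (g : A -> C) : Prop :=
  forall a b, f a = f b -> g a = g b.

(** * Shannon entropy on a finite probability space *)

Section Entropy.
Context {R : realType} {A : finType}.
Variable p : A -> R.
Hypothesis p_ge0 : forall a, 0 <= p a.
Hypothesis p_sum1 : \sum_a p a = 1.

Definition marg {B : finType} (f : A -> B) (b : B) : R := \sum_(a | f a == b) p a.

(** Variables are functions on one finite space [A] with mass function [p]; [entropy_comp]
    identifies this with [entropy] when [p] is the law of a joint random variable. *)
Definition Ent {B : finType} (f : A -> B) : R :=
  - \sum_b marg f b * log2 (marg f b).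

Lemma marg_ge0 {B : finType} (f : A -> B) b : 0 <= marg f b.
Proof. exact: sumr_ge0. Qed.

Lemma marg_ge {B : finType} (f : A -> B) a : p a <= marg f (f a).
Proof. by rewrite /marg (bigD1 a) //= lerDl sumr_ge0. Qed.

Lemma marg_gt0 {B : finType} (f : A -> B) a : 0 < p a -> 0 < marg f (f a).
Proof. by move=> /lt_le_trans; apply; exact: marg_ge. Qed.

Lemma sum_marg {B : finType} (f : A -> B) (F : B -> R) :
  \sum_b marg f b * F b = \sum_a p a * F (f a).
Proof.
rewrite [RHS](partition_big f predT) //=; apply: eq_bigr => b _.
by rewrite /marg mulr_suml; apply: eq_bigr => a /eqP ->.
Qed.

Lemma marg_sum1 {B : finType} (f : A -> B) : \sum_b marg f b = 1.
Proof.
have := sum_marg f (fun=> 1); under eq_bigr do rewrite mulr1; move=> ->.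
by under eq_bigr do rewrite mulr1.
Qed.

Lemma marg_pair_sum {B C : finType} (f : A -> B) (g : A -> C) c :
  \sum_b marg (fun a => (f a, g a)) (b, c) = marg g c.
Proof.
rewrite [RHS]/marg (partition_big f predT) //=; apply: eq_bigr => b _.
by apply: eq_bigl => a; rewrite xpair_eqE andbC.
Qed.

(** Averaging over [A] puts the entropies of different variables under one sum, where they are
    compared term by term. *)
Lemma EntE {B : finType} (f : A -> B) :
  Ent f = - \sum_a p a * log2 (marg f (f a)).
Proof. by rewrite /Ent (sum_marg f (fun b => log2 (marg f b))). Qed.

(** Cross-entropy against a subprobability [r] dominates entropy because [log2 x <= (x - 1) / ln 2].
    Suitable choices of [r] give the cardinality bound, submodularity and Fano's inequality. *)
Lemma gibbs {B : finType} (f : A -> B) (r : B -> R) :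
  (forall b, 0 <= r b) -> \sum_b r b <= 1 -> (forall a, 0 < p a -> 0 < r (f a)) ->
  Ent f <= - \sum_a p a * log2 (r (f a)).
Proof.
move=> r0 r1 rpos; rewrite EntE lerN2 -subr_le0 -sumrB.
pose F b := (r b / marg f b - 1) / ln 2.
apply: (@le_trans _ _ (\sum_a p a * F (f a))).
  apply: ler_sum => a _; have := p_ge0 a; rewrite le_eqVlt => /predU1P[<-|pa].
    by rewrite !mul0r subrr.
  have ra := rpos _ pa; have ma := marg_gt0 f a pa.
  rewrite -mulrBr ler_pM2l // /F.
  rewrite -log2V // -log2M ?invr_gt0 //; apply: log2_le_sub1.
  by rewrite divr_gt0.
rewrite -(sum_marg f F).
under eq_bigr do rewrite /F mulrA mulrBr mulr1.
rewrite -mulr_suml sumrB marg_sum1 pmulr_lle0 ?invr_gt0 ?ln2_gt0 // subr_le0.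
apply: le_trans r1; apply: ler_sum => b _.
(* Equality on the support; off it the left side is 0 and [r b] is merely dropped. *)
have [->|m0] := eqVneq (marg f b) 0; first by rewrite mul0r.
by rewrite mulrCA divff // mulr1.
Qed.

(** Each fibre of [f] lies inside a fibre of [g], so the marginal of [g] is pointwise the larger
    one. *)
Lemma Ent_mono {B C : finType} (f : A -> B) (g : A -> C) :
  determines f g -> Ent g <= Ent f.
Proof.
move=> fg; rewrite !EntE lerN2; apply: ler_sum => a _.
have := p_ge0 a; rewrite le_eqVlt => /predU1P[<-|pa]; first by rewrite !mul0r.
rewrite ler_pM2l //; apply: ler_log2; first exact: marg_gt0.
rewrite /marg [leRHS](bigID (fun b => f b == f a)) /=.
rewrite [leLHS](eq_bigl (fun b => (g b == g a) && (f b == f a))); last first.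
  by move=> b; apply/idP/andP => [/eqP/[dup]/fg -> ->|[]] //; rewrite !eqxx.
by rewrite lerDl sumr_ge0.
Qed.

Lemma Ent_eq {B C : finType} (f : A -> B) (g : A -> C) :
  determines f g -> determines g f -> Ent f = Ent g.
Proof. by move=> ? ?; apply/eqP; rewrite eq_le !Ent_mono. Qed.

Lemma Ent_le_card {B : finType} (f : A -> B) : Ent f <= log2 #|B|%:R.
Proof.
(* Total mass 1 forces [A], hence [B], to be inhabited. *)
have [a _] : exists a : A, true.
  apply/not_existsP => noA; have /eqP := p_sum1.
  rewrite big1; last by move=> a; have := noA a.
  by rewrite eq_sym oner_eq0.
have B0 : 0 < #|B|%:R :> R by rewrite ltr0n; apply/card_gt0P; exists (f a).
apply: le_trans (@gibbs _ f (fun=> #|B|%:R^-1) _ _ _) _.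
- by move=> b; rewrite invr_ge0 ltW.
- by rewrite sumr_const -[_ *+ _]mulr_natr mulVf // gt_eqF.
- by move=> b _; rewrite invr_gt0.
by rewrite -mulr_suml p_sum1 mul1r log2V // opprK.
Qed.

Lemma submod3 {B C D : finType} (f : A -> B) (g : A -> C) (h : A -> D) :
  Ent (fun a => (f a, g a, h a)) + Ent h <=
  Ent (fun a => (f a, h a)) + Ent (fun a => (g a, h a)).
Proof.
(* Gibbs against the law making f and g conditionally independent given h. *)
pose r (t : B * C * D) := marg (fun a => (f a, h a)) (t.1.1, t.2) *
   marg (fun a => (g a, h a)) (t.1.2, t.2) / marg h t.2.
apply: (@le_trans _ _ (- \sum_a p a * log2 (r (f a, g a, h a)) + Ent h)).
  rewrite lerD2r; apply: (@gibbs _ (fun a => (f a, g a, h a)) r).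
  - by move=> t; rewrite /r mulr_ge0 ?invr_ge0 ?mulr_ge0 ?marg_ge0.
  - rewrite -(pair_bigA _ (fun t d => r (t, d))) exchange_big /=.
    rewrite -(marg_sum1 h); apply: ler_sum => d _.
    rewrite -(pair_bigA _ (fun b c => r (b, c, d))) /= /r /=.
    under eq_bigr => b _ do rewrite -mulr_suml -mulr_sumr marg_pair_sum.
    rewrite -!mulr_suml marg_pair_sum.
    have [->|m0] := eqVneq (marg h d) 0; first by rewrite !mul0r.
    by rewrite mulfK.
  - move=> a pa; rewrite /r /= divr_gt0 ?mulr_gt0 //.
    + exact: (@marg_gt0 _ (fun a => (f a, h a))).
    + exact: (@marg_gt0 _ (fun a => (g a, h a))).
    + exact: marg_gt0.
rewrite !EntE -!opprD lerN2 -!big_split /=; apply: ler_sum => a _.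
have := p_ge0 a; rewrite le_eqVlt => /predU1P[<-|pa]; first by rewrite !mul0r addr0.
rewrite -!mulrDr ler_pM2l // /r /=.
have h1 := @marg_gt0 _ (fun a => (f a, h a)) a pa.
have h2 := @marg_gt0 _ (fun a => (g a, h a)) a pa.
have h3 := @marg_gt0 _ h a pa.
by rewrite log2M ?invr_gt0 ?mulr_gt0 // log2V // subrK log2M.
Qed.

(** Nonnegativity of I(f; g | h) in lattice form: [h] is a common part of [f] and [g], and [e] is
    anything they recover jointly. This is the main tool of the converse. *)
Lemma Ent_submodular {E B C D : finType}
    (e : A -> E) (f : A -> B) (g : A -> C) (h : A -> D) :
  determines (fun a => (f a, g a)) e -> determines f h -> determines g h ->
  Ent e + Ent h <= Ent f + Ent g.
Proof.
move=> de df dg; have := submod3 f g h.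
rewrite (@Ent_eq _ _ (fun a => (f a, h a)) f); last 2 first.
- by move=> a b [].
- by move=> a b ab; rewrite ab (df _ _ ab).
rewrite (@Ent_eq _ _ (fun a => (g a, h a)) g); last 2 first.
- by move=> a b [].
- by move=> a b ab; rewrite ab (dg _ _ ab).
apply: le_trans; rewrite lerD2r; apply: Ent_mono => a b [fab gab _].
by apply: de; rewrite fab gab.
Qed.

Lemma Ent_unit (f : A -> unit) : Ent f = 0.
Proof.
rewrite EntE big1 ?oppr0 // => a _.
have -> : marg f (f a) = 1; last by rewrite /log2 ln1 mul0r mulr0.
by rewrite -[RHS]p_sum1 /marg; apply: eq_bigl => b; case: (f b); case: (f a).
Qed.

Lemma Ent_subadditive {E B C : finType} (e : A -> E) (f : A -> B) (g : A -> C) :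
  determines (fun a => (f a, g a)) e -> Ent e <= Ent f + Ent g.
Proof.
by move=> de; rewrite -[Ent e]addr0 -(Ent_unit (fun=> tt)); apply: Ent_submodular.
Qed.

Lemma fano {B C : finType} (w : A -> B) (y : A -> C) (dec : C -> B) :
  Ent (fun a => (w a, y a)) - Ent y <=
  1 + (\sum_(a | dec (y a) != w a) p a) * log2 #|B|%:R.
Proof.
(* Gibbs against: given y, half the mass on dec y and the other half spread uniformly. *)
pose r (t : B * C) := marg y t.2 * (if dec t.2 == t.1 then 2^-1 else (2 * #|B|%:R)^-1).
have Bpos (a : A) : 0 < #|B|%:R :> R by rewrite ltr0n; apply/card_gt0P; exists (w a).
have r0 t : 0 <= r t.
  rewrite mulr_ge0 ?marg_ge0 //; case: ifP => _; rewrite invr_ge0 ?mulr_ge0 //.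
rewrite lerBlDr; apply: le_trans (@gibbs _ (fun a => (w a, y a)) r r0 _ _) _.
- rewrite -(pair_bigA _ (fun b c => r (b, c))) exchange_big /=.
  rewrite -(marg_sum1 y); apply: ler_sum => c _; rewrite /r /= -mulr_sumr.
  rewrite -[leRHS]mulr1 ler_wpM2l ?marg_ge0 //.
  apply: (@le_trans _ _ (2^-1 + \sum_(b : B) (2 * #|B|%:R)^-1)).
    rewrite (bigD1 (dec c)) //= eqxx lerD2l [leRHS](bigD1 (dec c)) //=.
    rewrite -[leLHS]add0r lerD ?invr_ge0 ?mulr_ge0 //.
    by apply: ler_sum => b /negbTE; rewrite eq_sym => ->.
  have B0 : 0 < #|B|%:R :> R by rewrite ltr0n; apply/card_gt0P; exists (dec c).
  rewrite sumr_const -[(_ * _)^-1 *+ _]mulr_natr invfM -mulrA mulVf ?gt_eqF // mulr1.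
  by rewrite -[2^-1]div1r -splitr.
- move=> a pa; rewrite /r /= mulr_gt0 ?marg_gt0 //.
  by case: ifP => _; rewrite invr_gt0 ?mulr_gt0 ?(Bpos a).
(* Spreading the constant 1 as total mass makes the claim pointwise: beyond the cost of [y], a
   correct guess costs one bit and a wrong one [1 + log2 #|B|]. *)
rewrite EntE -[X in X + _ * _]p_sum1 (big_mkcond (fun a => dec (y a) != w a)) mulr_suml.
rewrite -!sumrN -!big_split /=; apply: ler_sum => a _.
have := p_ge0 a; rewrite le_eqVlt => /predU1P[<-|pa].
  by rewrite !mul0r oppr0 addr0 if_same mul0r addr0.
have ma := marg_gt0 y a pa; have Ba := Bpos a.
rewrite /r /= log2M //; last by case: ifP; rewrite invr_gt0 ?mulr_gt0.
case: (eqVneq (dec (y a)) (w a)) => _ /=.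
  by rewrite log2V // log2_2 mulrBr mulr1 opprB mul0r addr0.
rewrite log2V ?mulr_gt0 // log2M // log2_2 le_eqVlt.
by apply/orP; left; apply/eqP; ring.
Qed.

(** The equality case of [submod3]. The factors [u] and [v] are not normalised: both products of
    marginals equal [u * v] times the sums of [u] and of [v]. *)
Lemma Ent_cond_indep {B C D : finType} (f : A -> B) (g : A -> C) (h : A -> D)
    (u : B -> D -> R) (v : C -> D -> R) :
  (forall b c d, marg (fun a => (f a, g a, h a)) (b, c, d) = u b d * v c d) ->
  Ent (fun a => (f a, g a, h a)) + Ent h =
  Ent (fun a => (f a, h a)) + Ent (fun a => (g a, h a)).
Proof.
move=> fgh.
have gh c d : marg (fun a => (g a, h a)) (c, d) = (\sum_b u b d) * v c d.
  rewrite -(marg_pair_sum f) mulr_suml; apply: eq_bigr => b _.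
  rewrite -fgh; apply: eq_bigl => a; rewrite !xpair_eqE; exact: andbA.
have fh b d : marg (fun a => (f a, h a)) (b, d) = u b d * (\sum_c v c d).
  rewrite -(marg_pair_sum g) mulr_sumr; apply: eq_bigr => c _.
  rewrite -fgh; apply: eq_bigl => a; rewrite !xpair_eqE.
  by case: (f a == b); case: (g a == c).
have hh d : marg h d = (\sum_b u b d) * (\sum_c v c d).
  rewrite -(marg_pair_sum f); under eq_bigr do rewrite fh.
  by rewrite mulr_suml.
rewrite !EntE -!opprD -!big_split /=; congr (- _); apply: eq_bigr => a _.
have := p_ge0 a; rewrite le_eqVlt => /predU1P[<-|pa]; first by rewrite !mul0r.
have h1 := @marg_gt0 _ (fun a => (f a, h a)) a pa.
have h2 := @marg_gt0 _ (fun a => (g a, h a)) a pa.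
have h3 := @marg_gt0 _ h a pa.
have h4 := @marg_gt0 _ (fun a => (f a, g a, h a)) a pa.
rewrite -!mulrDr -!log2M //; congr (_ * log2 _).
by rewrite fgh hh fh gh; ring.
Qed.

Lemma Ent_independent {B C : finType} (f : A -> B) (g : A -> C)
    (u : B -> R) (v : C -> R) :
  (forall b c, marg (fun a => (f a, g a)) (b, c) = u b * v c) ->
  Ent (fun a => (f a, g a)) = Ent f + Ent g.
Proof.
move=> fg.
have := @Ent_cond_indep _ _ _ f g (fun=> tt) (fun b _ => u b) (fun c _ => v c).
have tt_eq (D : finType) (h : A -> D) : Ent (fun a => (h a, tt)) = Ent h.
  by apply: Ent_eq => a b; [case|move->].
rewrite Ent_unit addr0 !tt_eq; apply=> b c [].
by rewrite -fg; apply: eq_bigl => a; rewrite xpair_eqE andbT.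
Qed.

End Entropy.

(** * Entropy inequalities behind the three rate bounds *)

Section Converse.
Context {R : realType} {A : finType}.
Variable p : A -> R.
Hypothesis p_ge0 : forall a, 0 <= p a.
Hypothesis p_sum1 : \sum_a p a = 1.
Local Notation H := (Ent p).

(** Adding [H w] to both sides gives I(w; z) <= I(w; y). It is submodularity of (w, z) and [y], with
    common part [z]. *)
Lemma data_processing {B C D : finType} (w : A -> B) (y : A -> C) (z : A -> D) :
  determines y z ->
  H z - H (fun a => (w a, z a)) <= H y - H (fun a => (w a, y a)).
Proof.
move=> yz; rewrite lerBlDr addrAC lerBrDr [leLHS]addrC [leRHS]addrC.
apply: Ent_submodular => //.
- by move=> a b [-> _ ->].
- by move=> a b [].
Qed.

Context {B1 B2 V X1 X2 Y1 Y2 S L M : finType}.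
Variables (w1 : A -> B1) (w2 : A -> B2) (v : A -> V) (x1 : A -> X1) (x2 : A -> X2).
(* s, l, u stand for the common top rows T and the remaining rows of y1 and of y2. *)
Variables (y1 : A -> Y1) (y2 : A -> Y2) (s : A -> S) (l : A -> L) (u : A -> M).
Hypothesis markov :
  H (fun a => (x1 a, x2 a, (w1 a, v a))) + H (fun a => (w1 a, v a)) =
  H (fun a => (x1 a, (w1 a, v a))) + H (fun a => (x2 a, (w1 a, v a))).
Hypothesis w1_indep : H (fun a => (w1 a, x2 a)) = H w1 + H x2.
Hypothesis y1x2_x1 : determines (fun a => (y1 a, x2 a)) x1.
Hypothesis y1x1_x2 : determines (fun a => (y1 a, x1 a)) x2.
Hypothesis x2_y2 : determines x2 y2.
Hypothesis y1_s : determines y1 s.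
Hypothesis y2_s : determines y2 s.
Hypothesis sl_y1 : determines (fun a => (s a, l a)) y1.
Hypothesis su_y2 : determines (fun a => (s a, u a)) y2.

Lemma info_w1_y1 :
  H w1 + H y1 - H (fun a => (w1 a, y1 a)) +
  (H (fun a => (x1 a, (w1 a, v a))) - H (fun a => (w1 a, v a))) <= H l.
Proof.
have x2_s : determines x2 s by move=> a b /x2_y2/y2_s.
have e1 := Ent_subadditive p p_ge0 p_sum1 _ _ _ sl_y1.
(* Independence of [w1] and [x2] passes to [s]: with [w1_indep] this reads H(w1, s) >= H(w1) +
   H(s). *)
have e2 := data_processing w1 _ _ x2_s.
(* The variables (w1, y1) and (x2, w1, v) share (w1, s) and jointly recover [x1]. With [markov],
   H(w1, y1) >= H(w1, s) + H(x1 | w1, v). *)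
have e3 : H (fun a => (x1 a, x2 a, (w1 a, v a))) + H (fun a => (w1 a, s a)) <=
    H (fun a => (w1 a, y1 a)) + H (fun a => (x2 a, (w1 a, v a))).
  apply: Ent_submodular => //.
  - move=> a b [-> yy xx _ ->]; rewrite xx; congr (_, _, _).
    by apply: y1x2_x1; rewrite yy xx.
  - by move=> a b [-> /y1_s ->].
  - by move=> a b [/x2_s -> ->].
move: markov w1_indep e1 e2 e3; lra.
Qed.

(** On the right, H(w1, y1) - H(y1) is the equivocation of [w1] at receiver 1, to be bounded by
    Fano; the last difference is the one that [info_w1_y1] has on its left. *)
Lemma info_w2_y2 :
  H w2 + H y2 - H (fun a => (w2 a, y2 a)) <=
  H w2 + H y1 - H (fun a => (w2 a, y1 a)) +
  (H (fun a => (w1 a, y1 a)) - H y1) + H v +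
  (H (fun a => (x1 a, (w1 a, v a))) - H (fun a => (w1 a, v a))).
Proof.
pose g a := (x2 a, v a, (w1 a, y1 a)).
have e1 : H y2 - H (fun a => (w2 a, y2 a)) <= H g - H (fun a => (w2 a, g a)).
  by apply: data_processing => a b [/x2_y2].
(* With [e1], the excess of I(w2; y2) over I(w2; y1) is at most H(g) - H(y1); the next two steps
   bound H(g). *)
have e2 : H (fun a => (w2 a, y1 a)) <= H (fun a => (w2 a, g a)).
  by apply: Ent_mono => // a b [-> _ _ _ ->].
have e3 : H g + H (fun a => (w1 a, v a)) <=
    H (fun a => (x1 a, (w1 a, v a))) + H (fun a => (v a, (w1 a, y1 a))).
  apply: Ent_submodular => //.
  - move=> a b [xx ww vv _ _ yy]; rewrite /g ww vv yy; congr (_, _, _).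
    by apply: y1x1_x2; rewrite yy xx.
  - by move=> a b [_ -> ->].
  - by move=> a b [-> ->].
have e4 : H (fun a => (v a, (w1 a, y1 a))) <= H v + H (fun a => (w1 a, y1 a)).
  exact: Ent_subadditive.
move: e1 e2 e3 e4; lra.
Qed.

(** The rows [s] are also part of [y1], so what they reveal about [w2] is charged to the leakage and
    only [u] is left to count. *)
Lemma info_w2_y2_top :
  H w2 + H y2 - H (fun a => (w2 a, y2 a)) <=
  H w2 + H y1 - H (fun a => (w2 a, y1 a)) + H u.
Proof.
have e1 := Ent_subadditive p p_ge0 p_sum1 _ _ _ su_y2.
have e2 := data_processing w2 _ _ y1_s.
have e3 : H (fun a => (w2 a, s a)) <= H (fun a => (w2 a, y2 a)).
  by apply: Ent_mono => // a b [-> /y2_s ->].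
move: e1 e2 e3; lra.
Qed.

End Converse.

(** * Rows of the channel outputs *)

Section Channel.

(** Indexing by [nat] with default 0 allows shifted indices and different heights without casts
    between ordinals. *)
Definition entry {k} (x : 'cV['F_2]_k) (j : nat) : 'F_2 :=
  if insub j is Some i then x i 0 else 0.

Lemma entryE {k} (x : 'cV['F_2]_k) (i : 'I_k) : entry x i = x i 0.
Proof. by rewrite /entry valK. Qed.

Definition rows (k l : nat) {h} (x : 'cV['F_2]_h) : 'cV['F_2]_l :=
  \col_(i < l) entry x (k + i).

Lemma entry_inj {k} (x y : 'cV['F_2]_k) :
  (forall i, (i < k)%N -> entry x i = entry y i) -> x = y.
Proof.
move=> xy; apply/matrixP => i j; rewrite ord1 -!entryE; exact: xy.
Qed.

Lemma entry_col {k} (F : 'I_k -> 'F_2) i (ik : (i < k)%N) :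
  entry (\col_j F j) i = F (Ordinal ik).
Proof. by rewrite /entry insubT mxE. Qed.

Lemma rowsP k l {h} (x y : 'cV['F_2]_h) :
  rows k l x = rows k l y <->
  forall i, (k <= i < k + l)%N -> entry x i = entry y i.
Proof.
split=> [xy i /andP[ki il]|xy].
  have il' : (i - k < l)%N by lia.
  have := congr1 (fun z => entry z (i - k)) xy.
  by rewrite /rows !(entry_col _ _ il') /= subnKC.
by apply/matrixP => i j; rewrite !mxE xy //; have := ltn_ord i; lia.
Qed.

Lemma entry_zero_pad {k l} (x : 'cV['F_2]_k) i :
  (i < l)%N -> entry (zero_pad l x) i = entry x i.
Proof. by move=> il; rewrite /zero_pad (entry_col _ _ il). Qed.

Lemma entryD {k} (x y : 'cV['F_2]_k) i : entry (x + y) i = entry x i + entry y i.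
Proof. by rewrite /entry; case: insubP => [j _ _|_]; rewrite ?mxE ?addr0. Qed.

Lemma entry_downshiftX {h} k (x : 'cV['F_2]_h) i : (i < h)%N ->
  entry (downshift h ^+ k *m x) i = if (k <= i)%N then entry x (i - k) else 0.
Proof.
elim: k i => [|k IHk] i ih; first by rewrite expr0 mul1mx subn0.
rewrite exprS -mulmxA /entry insubT /= mxE.
(* The first row of [downshift] is zero, and row [i.+1] picks entry [i]. *)
case: i ih => [|i] ih.
  by rewrite big1 // => j _; rewrite mxE mul0r.
have ih' : (i < h)%N by lia.
rewrite (bigD1 (Ordinal ih')) //= big1 ?addr0; last first.
  move=> j jne; rewrite mxE /= eqSS; case: eqP => [ij|]; last by rewrite mul0r.
  by case/eqP: jne; apply: val_inj.
rewrite mxE /= eqxx mul1r -entryE /= IHk //.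
Qed.

Context {m n : nat}.
Hypothesis mn : (m <= n)%N.

(** Since [m <= n], vectors have length [n]: [x2] arrives unshifted, while [x1] is pushed down by
    [n - m] rows and leaves the rows above it clear. *)
Lemma entry_zic_output1 (a : 'cV['F_2]_m) (b : 'cV['F_2]_(maxn m n)) i :
  (i < maxn m n)%N -> entry (zic_output1 a b) i =
  (if (n - m <= i)%N then entry a (i - (n - m)) else 0) + entry b i.
Proof.
move=> iq; rewrite entryD !entry_downshiftX // (_ : maxn m n - n = 0)%N; last by lia.
rewrite leq0n subn0 (_ : maxn m n - m = n - m)%N; last by lia.
by case: ifP => // _; rewrite entry_zero_pad //; lia.
Qed.

Lemma zic_output1_injl (b : 'cV['F_2]_(maxn m n)) :
  injective (fun a : 'cV['F_2]_m => zic_output1 a b).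
Proof.
move=> a a' aa'; apply: entry_inj => i im.
have iq : (n - m + i < maxn m n)%N by lia.
have := congr1 (fun z => entry z (n - m + i)) aa'.
by rewrite !entry_zic_output1 // leq_addr addKn => /addIr.
Qed.

Lemma zic_output1_injr (a : 'cV['F_2]_m) : injective (@zic_output1 m n a).
Proof.
move=> b b' bb'; apply: entry_inj => i iq.
by have := congr1 (entry ^~ i) bb'; rewrite !entry_zic_output1 // => /addrI.
Qed.

Lemma rows_zic_output1 (a : 'cV['F_2]_m) (b : 'cV['F_2]_(maxn m n)) :
  rows 0 (n - m) (zic_output1 a b) = rows 0 (n - m) b.
Proof.
apply/rowsP => i /andP[_ i_lt]; rewrite entry_zic_output1; last by lia.
by rewrite leqNgt i_lt add0r.
Qed.

Lemma rows_inj (y y' : 'cV['F_2]_(maxn m n)) :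
  rows 0 (n - m) y = rows 0 (n - m) y' -> rows (n - m) m y = rows (n - m) m y' ->
  y = y'.
Proof.
move=> /rowsP yt /rowsP yb; apply: entry_inj => i iq.
by have [ti|ti] := ltnP i (n - m); [apply: yt|apply: yb]; lia.
Qed.

(** The shift by [n - m] pushes all but the top [m] entries out of the vector. *)
Lemma zic_output2P (b b' : 'cV['F_2]_(maxn m n)) :
  zic_output2 b = zic_output2 b' <-> rows 0 m b = rows 0 m b'.
Proof.
have qm : (maxn m n - m = n - m)%N by lia.
split=> [bb'|/rowsP bb'].
  apply/rowsP => i im; have iq : (n - m + i < maxn m n)%N by lia.
  have := congr1 (entry ^~ (n - m + i)%N) bb'.
  by rewrite /zic_output2 !entry_downshiftX // qm leq_addr addKn.
apply: entry_inj => i iq; rewrite /zic_output2 !entry_downshiftX // qm.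
by case: ifP => // ?; apply: bb'; lia.
Qed.

End Channel.

(** * From random variables to finite mass functions *)

Section FiniteVariable.
Context {d : measure_display} {T : measurableType d} {R : realType}.
Variable P : probability T R.
Context {A : finType}.
Variable Z : T -> A.
Hypothesis Z_rv : finite_rv Z.

Lemma pr_preimage (E : pred A) :
  pr P (Z @^-1` [set a | E a]) = \sum_(a | E a) mass P Z a.
Proof.
rewrite /pr (_ : Z @^-1` [set a | E a] = \bigcup_(a in [set` E]) Z @^-1` [set a]).
  rewrite measure_fin_bigcup //=; last first.
    by move=> a b _ _ [ o [/= <- <-]].
  rewrite -(@bigfs _ _ _ _ (index_enum A)) ?index_enum_uniq //; last first.
    by move=> a _; rewrite mem_index_enum.
  by rewrite -sum_fine // => a _; apply: fin_num_measure.
by apply/seteqP; split => [ o Eo|o [a Ea /= Zo]] /=; [exists (Z o)|rewrite Zo].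
Qed.

Lemma mass_ge0 a : 0 <= mass P Z a.
Proof. by rewrite /mass /pr fine_ge0. Qed.

Lemma mass_sum1 : \sum_a mass P Z a = 1.
Proof.
rewrite -(pr_preimage predT) /pr (_ : _ @^-1` _ = setT) ?probability_setT //.
by apply/seteqP; split.
Qed.

Lemma mass_comp {B : finType} (f : A -> B) b :
  mass P (fun o => f (Z o)) b = marg (mass P Z) f b.
Proof.
rewrite /marg -pr_preimage; congr (pr P _).
by apply/seteqP; split => o /= /eqP.
Qed.

Lemma entropy_comp {B : finType} (f : A -> B) :
  entropy P (fun o => f (Z o)) = Ent (mass P Z) f.
Proof. by congr (- _); apply: eq_bigr => b _; rewrite mass_comp. Qed.

(** Passes from the divergence form of [mutual_info] to entropies; points of mass 0 are split off
    before the logarithm of the quotient is expanded. *)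
Lemma mutual_info_comp {B C : finType} (f : A -> B) (g : A -> C) :
  mutual_info P (fun o => f (Z o)) (fun o => g (Z o)) =
  Ent (mass P Z) f + Ent (mass P Z) g - Ent (mass P Z) (fun a => (f a, g a)).
Proof.
rewrite /mutual_info pair_bigA /=.
pose p := mass P Z; pose fg a := (f a, g a).
pose F (c : B * C) := log2 (marg p fg c / (marg p f c.1 * marg p g c.2)).
transitivity (\sum_c marg p fg c * F c).
  apply: eq_bigr => -[b c] _; rewrite /F /= !mass_comp.
  by rewrite (mass_comp fg).
rewrite sum_marg !EntE opprK -!sumrN -!big_split /=; apply: eq_bigr => a _.
have := mass_ge0 a; rewrite -/p le_eqVlt => /predU1P[<-|pa].
  by rewrite !mul0r oppr0 !addr0.
have h1 := marg_gt0 p mass_ge0 f a pa.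
have h2 := marg_gt0 p mass_ge0 g a pa.
have h3 := marg_gt0 p mass_ge0 fg a pa.
rewrite /F /= log2M ?invr_gt0 ?mulr_gt0 // log2V ?mulr_gt0 // log2M //.
by ring.
Qed.

Lemma Ent_uniform {B : finType} (f : A -> B) : (0 < #|B|)%N ->
  uniform_rv P (fun o => f (Z o)) -> Ent (mass P Z) f = log2 #|B|%:R.
Proof.
move=> B0 unif; rewrite EntE.
under eq_bigr => a _ do rewrite -mass_comp unif log2V ?ltr0n //.
by rewrite -mulr_suml mass_sum1 mul1r opprK.
Qed.

End FiniteVariable.

(** * Independence from a factorised joint law *)

Section Factorization.
Context {R : realType} {B1 B2 V X1 X2 : finType}.
Variable p : B1 * B2 * V * X1 * X2 -> R.
Variables (f : B1 -> R) (k1 : B1 -> V -> X1 -> R) (k2 : B2 -> V -> X2 -> R).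
Hypothesis p_ge0 : forall a, 0 <= p a.
Hypothesis p_sum1 : \sum_a p a = 1.
Hypothesis k1_sum1 : forall a v, \sum_x k1 a v x = 1.
Hypothesis pE : forall a b v x y, p (a, b, v, x, y) = f a * k1 a v x * k2 b v y.

(** In [pE], [f] stands for the law of W1, [k1] for the kernel from (W1, v21) to x1, and [k2] for
    the joint mass of (W2, v21, x2). Summing out W2 leaves a product linking x1 and x2 only through
    (W1, v21). *)
Lemma Ent_markov :
  Ent p (fun t => (t.1.2, t.2, (t.1.1.1.1, t.1.1.2))) +
  Ent p (fun t => (t.1.1.1.1, t.1.1.2)) =
  Ent p (fun t => (t.1.2, (t.1.1.1.1, t.1.1.2))) +
  Ent p (fun t => (t.2, (t.1.1.1.1, t.1.1.2))).
Proof.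
apply: (@Ent_cond_indep _ _ p p_ge0 _ _ _ (fun t => t.1.2) (fun t => t.2)
  (fun t => (t.1.1.1.1, t.1.1.2)) (fun x av => f av.1 * k1 av.1 av.2 x)
  (fun y av => \sum_b k2 b av.2 y)) => x y [a v] /=.
rewrite /marg (partition_big (fun t => t.1.1.1.2) predT) //= mulr_sumr.
apply: eq_bigr => b _; rewrite -pE; apply: big_pred1 => -[[[[a' b'] v'] x'] y'] /=.
by rewrite /= !xpair_eqE; do 5!case: eqP => //=.
Qed.

(** Summing out x1 first turns the kernel [k1] into 1, and with it goes the only link between W1 and
    v21. *)
Lemma Ent_indep :
  Ent p (fun t => (t.1.1.1.1, t.2)) = Ent p (fun t => t.1.1.1.1) + Ent p (fun t => t.2).
Proof.
apply: (@Ent_independent _ _ p p_ge0 p_sum1 _ _ (fun t => t.1.1.1.1) (fun t => t.2) f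
  (fun y => \sum_b \sum_v k2 b v y)) => a y.
rewrite /marg (partition_big (fun t => (t.1.1.1.2, t.1.1.2, t.1.2)) predT) //=.
rewrite -(pair_bigA _ (fun bv x => \sum_(t | _ && (_ == (bv, x))) p t)) /=.
rewrite -(pair_bigA _ (fun b v => \sum_x \sum_(t | _ && (_ == (b, v, x))) p t)) /=.
rewrite mulr_sumr; apply: eq_bigr => b _; rewrite mulr_sumr; apply: eq_bigr => v _.
transitivity (\sum_x f a * k1 a v x * k2 b v y).
  apply: eq_bigr => x _; rewrite -pE; apply: big_pred1 => -[[[[a' b'] v'] x'] y'] /=.
  by rewrite /= !xpair_eqE; do 5!case: eqP => //=.
by rewrite -mulr_suml -mulr_sumr k1_sum1 mulr1.
Qed.

End Factorization.

(** * The converse for a single code *)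

Section Code.
Context {R : realType} {m n C N M1 M2 : nat} (c : zic_code R m n C N M1 M2).

Definition joint (o : Omega c) := (W1 o, W2 o, v21 o, x1 o, x2 o).

(** With the messages and [v21] fixed, the encoder outputs become conditions on [U1] alone and on
    [U2] alone: one event per independent source. *)
Lemma joint_fibre a b v x y : joint @^-1` [set (a, b, v, x, y)] =
  (@W1 _ _ _ _ _ _ _ c) @^-1` [set a] `&` (@W2 _ _ _ _ _ _ _ c) @^-1` [set b] `&`
  U1 c @^-1` (enc1 a v @^-1` [set x]) `&`
  U2 c @^-1` (coop b @^-1` [set v] `&` enc2 b @^-1` [set y]).
Proof.
apply/seteqP; split => [ o [<- <- <- <- <-] //|o [[[/= aE bE] xE] [vE yE]]].
by rewrite /joint /x1 /x2 /v21 aE bE vE xE yE.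
Qed.

Lemma joint_rv : finite_rv joint.
Proof.
move=> [[[[a b] v] x] y]; rewrite joint_fibre.
apply: measurableI; [apply: measurableI; [apply: measurableI|]|].
- exact: W1_rv.
- exact: W2_rv.
- exact: (measurable_funPTI (U1 c) (enc1_measurable _ _ _)).
- apply: (measurable_funPTI (U2 c)).
  by apply: measurableI; [apply: coop_measurable|apply: enc2_measurable].
Qed.

Lemma mass_joint a b v x y : mass (prob c) joint (a, b, v, x, y) =
  mass (prob c) (@W1 _ _ _ _ _ _ _ c) a *
  mass (prob c) (fun o => enc1 a v (U1 c o)) x *
  (mass (prob c) (@W2 _ _ _ _ _ _ _ c) b *
   pr (prob c) (U2 c @^-1` (coop b @^-1` [set v] `&` enc2 b @^-1` [set y]))).
Proof.
rewrite [LHS]/mass joint_fibre sources_independent.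
- by rewrite /mass; ring.
- exact: enc1_measurable.
- by apply: measurableI; [apply: coop_measurable|apply: enc2_measurable].
Qed.

Lemma mass_enc1_sum1 a v :
  \sum_x mass (prob c) (fun o => enc1 a v (U1 c o)) x = 1.
Proof.
apply: mass_sum1 => x; exact: (measurable_funPTI (U1 c) (enc1_measurable _ _ _)).
Qed.

Local Notation P := (prob c).
Local Notation H := (Ent (mass P joint)).
Local Notation tuple_type := ('I_M1 * 'I_M2 * block N (coop_alphabet c) *
  block N 'cV['F_2]_m * block N 'cV['F_2]_(maxn m n))%type.

Hypothesis mn : (m <= n)%N.
Hypothesis nm : (n <= m + m)%N.
Hypothesis N_gt0 : (0 < N)%N.
Hypothesis M1_gt0 : (0 < M1)%N.
Hypothesis M2_gt0 : (0 < M2)%N.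

(** All variables of the code as functions of the value of [joint]. [ts] is the part of [x2] that
    both receivers see in the clear; [tl] and [tu] complete it to [ty1] and to [ty2]. *)
Definition tw1 (t : tuple_type) := t.1.1.1.1.
Definition tw2 (t : tuple_type) := t.1.1.1.2.
Definition tv (t : tuple_type) := t.1.1.2.
Definition tx1 (t : tuple_type) := t.1.2.
Definition tx2 (t : tuple_type) := t.2.
Definition ty1 (t : tuple_type) : block N 'cV['F_2]_(maxn m n) :=
  [ffun i => zic_output1 (tx1 t i) (tx2 t i)].
Definition ty2 (t : tuple_type) : block N 'cV['F_2]_(maxn m n) :=
  [ffun i => zic_output2 (tx2 t i)].
Definition ts (t : tuple_type) : block N 'cV['F_2]_(n - m) :=
  [ffun i => rows 0 (n - m) (tx2 t i)].
Definition tl (t : tuple_type) : block N 'cV['F_2]_m :=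
  [ffun i => rows (n - m) m (ty1 t i)].
Definition tu (t : tuple_type) : block N 'cV['F_2]_(m + m - n) :=
  [ffun i => rows (n - m) (m + m - n) (tx2 t i)].

Let p_ge0 := mass_ge0 P joint.
Let p_sum1 := mass_sum1 P joint joint_rv.

Lemma log2_card_block k : log2 #|block N 'cV['F_2]_k|%:R = N%:R * k%:R :> R.
Proof.
rewrite card_ffun card_mx card_Fp // card_ord muln1 -expnM natrX log2X //.
by rewrite log2_2 mulr1 natrM mulrC.
Qed.

Lemma markov_code : H (fun a => (tx1 a, tx2 a, (tw1 a, tv a))) + H (fun a => (tw1 a, tv a)) =
  H (fun a => (tx1 a, (tw1 a, tv a))) + H (fun a => (tx2 a, (tw1 a, tv a))).
Proof. exact: (Ent_markov _ _ _ _ p_ge0 mass_joint). Qed.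

Lemma indep_code : H (fun a => (tw1 a, tx2 a)) = H tw1 + H tx2.
Proof. exact: (Ent_indep _ _ _ _ p_ge0 p_sum1 mass_enc1_sum1 mass_joint). Qed.

Lemma ty1_tx1 : determines (fun a => (ty1 a, tx2 a)) tx1.
Proof.
move=> a b [/ffunP yab xab]; apply/ffunP => i.
have := yab i; rewrite !ffunE xab; exact: zic_output1_injl.
Qed.

Lemma ty1_tx2 : determines (fun a => (ty1 a, tx1 a)) tx2.
Proof.
move=> a b [/ffunP yab xab]; apply/ffunP => i.
have := yab i; rewrite !ffunE xab; exact: zic_output1_injr.
Qed.

Lemma tx2_ty2 : determines tx2 ty2.
Proof. by move=> a b xab; apply/ffunP => i; rewrite !ffunE xab. Qed.

Lemma ty1_ts : determines ty1 ts.
Proof.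
move=> a b /ffunP yab; apply/ffunP => i; have := yab i; rewrite !ffunE => yabi.
by rewrite -(rows_zic_output1 mn (tx1 a i)) yabi rows_zic_output1.
Qed.

Lemma ty2_ts : determines ty2 ts.
Proof.
move=> a b /ffunP yab; apply/ffunP => i; have := yab i; rewrite !ffunE.
move=> /(zic_output2P mn)/rowsP xab; apply/rowsP => j jm; apply: xab; lia.
Qed.

Lemma tstl_ty1 : determines (fun a => (ts a, tl a)) ty1.
Proof.
move=> a b [/ffunP sab /ffunP lab]; apply/ffunP => i.
have := lab i; have := sab i; rewrite !ffunE => si li; apply: (rows_inj mn) => //.
by rewrite !rows_zic_output1.
Qed.

Lemma tstu_ty2 : determines (fun a => (ts a, tu a)) ty2.
Proof.
move=> a b [/ffunP sab /ffunP uab]; apply/ffunP => i.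
have := uab i; have := sab i; rewrite !ffunE => /rowsP si /rowsP ui.
apply/(zic_output2P mn)/rowsP => j jm.
by have [tj|tj] := ltnP j (n - m); [apply: si|apply: ui]; lia.
Qed.

Lemma H_tw1 : H tw1 = log2 M1%:R.
Proof.
rewrite -[in RHS](card_ord M1); apply: Ent_uniform; [exact: joint_rv|by rewrite card_ord|].
exact: W1_uniform.
Qed.

Lemma H_tw2 : H tw2 = log2 M2%:R.
Proof.
rewrite -[in RHS](card_ord M2); apply: Ent_uniform; [exact: joint_rv|by rewrite card_ord|].
exact: W2_uniform.
Qed.

Lemma H_tv : H tv <= N%:R * C%:R.
Proof. by rewrite -(entropy_comp P joint joint_rv tv); exact: coop_rate. Qed.

Lemma fano1 : H (fun a => (tw1 a, ty1 a)) - H ty1 <= 1 + error1 c * log2 M1%:R.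
Proof.
rewrite -[X in log2 X%:R](card_ord M1).
rewrite [error1 c](_ : _ = \sum_(a | dec1 c (ty1 a) != tw1 a) mass P joint a).
  exact: fano.
rewrite -pr_preimage; last exact: joint_rv.
by congr (pr P _); apply/seteqP; split => o /= /eqP.
Qed.

Lemma fano2 : H (fun a => (tw2 a, ty2 a)) - H ty2 <= 1 + error2 c * log2 M2%:R.
Proof.
rewrite -[X in log2 X%:R](card_ord M2).
rewrite [error2 c](_ : _ = \sum_(a | dec2 c (ty2 a) != tw2 a) mass P joint a).
  exact: fano.
rewrite -pr_preimage; last exact: joint_rv.
by congr (pr P _); apply/seteqP; split => o /= /eqP.
Qed.

Lemma leakageE : H tw2 + H ty1 - H (fun a => (tw2 a, ty1 a)) = N%:R * leakage c.
Proof.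
rewrite /leakage mulrA divff ?mul1r ?pnatr_eq0 -?lt0n //.
by rewrite -(mutual_info_comp P joint joint_rv tw2 ty1).
Qed.

(** In the sum bound Fano is applied twice at receiver 1, for I(W1; y1) and for the equivocation in
    [info_w2_y2], and once at receiver 2; hence the factor [2] and the constant [3]. *)
Lemma code_converse :
  [/\ log2 M1%:R * (1 - error1 c) <= N%:R * m%:R + 1,
     log2 M2%:R * (1 - error2 c) <= N%:R * (2 * m%:R - n%:R) + N%:R * leakage c + 1 &
     log2 M1%:R * (1 - 2 * error1 c) + log2 M2%:R * (1 - error2 c) <=
       N%:R * m%:R + N%:R * C%:R + N%:R * leakage c + 3].
Proof.
have iw1 := info_w1_y1 _ p_ge0 p_sum1 _ _ _ _ _ _ _ _
  markov_code indep_code ty1_tx1 tx2_ty2 ty1_ts ty2_ts tstl_ty1.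
have iw2 := info_w2_y2 _ p_ge0 p_sum1 tw1 tw2 tv _ _ _ _ ty1_tx2 tx2_ty2.
have iw2t := info_w2_y2_top _ p_ge0 p_sum1 tw2 _ _ _ _ ty1_ts ty2_ts tstu_ty2.
have f1 := fano1; have f2 := fano2; have hv := H_tv.
have hl : H tl <= N%:R * m%:R by rewrite -log2_card_block; exact: Ent_le_card.
have hu : H tu <= N%:R * (2 * m%:R - n%:R).
  rewrite (_ : 2 * m%:R - n%:R = (m + m - n)%:R :> R); last first.
    by rewrite natrB // natrD; lra.
  by rewrite -log2_card_block; exact: Ent_le_card.
have hx : H (fun a => (tw1 a, tv a)) <= H (fun a => (tx1 a, (tw1 a, tv a))).
  by apply: Ent_mono => // a b [_ -> ->].
have lk := leakageE; have h1 := H_tw1; have h2 := H_tw2.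
split; lra.
Qed.

End Code.

(** * Message counts *)

Section Messages.
Context {R : realType}.
Implicit Types (N : nat) (r : R).

Lemma message_count_ge N r : 2 `^ (N%:R * r) <= (message_count N r)%:R.
Proof.
rewrite /message_count natr_absz.
apply: le_trans (ceil_ge _) _; rewrite ler_int; exact: ler_norm.
Qed.

Lemma message_count_gt0 N r : (0 < message_count N r)%N.
Proof. by rewrite -(ltr0n R); apply: lt_le_trans (message_count_ge N r); rewrite powR_gt0. Qed.

Lemma log2_message_count N r : N%:R * r <= log2 (message_count N r)%:R.
Proof.
apply: le_trans (ler_log2 _ _ _ (message_count_ge N r)); last by rewrite powR_gt0.
by rewrite /log2 ln_powR mulfK // gt_eqF // ln2_gt0.
Qed.

End Messages.

(** * Rates per channel use, limits and closure *)

Lemma cvg_natr_inv {R : realType} (N : nat -> nat) : N @ \oo --> \oo ->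
  (fun k => (N k)%:R^-1 : R) @ \oo --> (0 : R).
Proof.
move=> Noo; apply: (cvg_comp N (fun j => j%:R^-1 : R) Noo).
(* The harmonic sequence is the inverse of [j.+1], hence the shift. *)
rewrite -cvg_shiftS /=; exact: cvg_harmonic.
Qed.

(** The limits on the errors make [1 - 2 * error1 c] and [1 - error2 c] nonnegative, so the lower
    bounds on the message counts may be multiplied by them before dividing by [N]. *)
Lemma code_rates {R : realType} {m n C N : nat} {R1 R2 : R}
    (c : zic_code R m n C N (message_count N R1) (message_count N R2)) :
  (m <= n)%N -> (n <= m + m)%N -> (0 < N)%N ->
  error1 c <= 1 / 2 -> error2 c <= 1 ->
  [/\ R1 * (1 - error1 c) <= m%:R + N%:R^-1,
     R2 * (1 - error2 c) <= 2 * m%:R - n%:R + leakage c + N%:R^-1 &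
     R1 * (1 - 2 * error1 c) + R2 * (1 - error2 c) <=
       m%:R + C%:R + leakage c + 3 * N%:R^-1].
Proof.
move=> mn nm N0 e1 e2.
have [] := code_converse c mn nm N0 (message_count_gt0 _ _) (message_count_gt0 _ _).
have l1 := log2_message_count N R1; have l2 := log2_message_count N R2.
move: (log2 (message_count N R1)%:R) (log2 (message_count N R2)%:R) l1 l2
  (error1 c) (error2 c) (leakage c) e1 e2 => {c}.
have NR : 0 < N%:R :> R by rewrite ltr0n.
move=> L1 L2 l1 l2 x1 x2 lk e1 e2 c1 c2 c3.
have N1 : N%:R * N%:R^-1 = 1 :> R by rewrite divff // gt_eqF.
have a1 : N%:R * R1 * (1 - x1) <= L1 * (1 - x1) by rewrite ler_wpM2r //; lra.
have a2 : N%:R * R2 * (1 - x2) <= L2 * (1 - x2) by rewrite ler_wpM2r //; lra.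
have a3 : N%:R * R1 * (1 - 2 * x1) <= L1 * (1 - 2 * x1) by rewrite ler_wpM2r //; lra.
by split; rewrite -(ler_pM2l NR); move: (N%:R^-1) N1 a1 a2 a3 c1 c2 c3 => i N1; nra.
Qed.

Lemma achievable_rates {R : realType} {m n C : nat} {R1 R2 : R} :
  (m <= n)%N -> (n <= m + m)%N -> achievable m n C (R1, R2) ->
  [/\ R1 <= m%:R, R2 <= 2 * m%:R - n%:R & R1 + R2 <= m%:R + C%:R].
Proof.
move=> mn nm [_ _ [N [c [/= Noo e1 e2 lk]]]].
have Ninv := @cvg_natr_inv R N Noo.
(* Only finitely many codes can violate the side conditions of [code_rates]. *)
have ev : \forall k \near \oo, [/\ (0 < N k)%N, error1 (c k) <= 1 / 2 & error2 (c k) <= 1].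
  near=> k; split.
  - by near: k; exact: (Noo _ (nbhs_infty_gt 0)).
  - by near: k; apply: (cvgr_le _ e1); lra.
  - by near: k; apply: (cvgr_le _ e2); lra.
(* [cvg_err] and [cvg_slack] are templates for the left and right sides of the three bounds. *)
have cvg_err r a (e : nat -> R) : e @ \oo --> (0 : R) ->
    (fun k => r * (1 - a * e k)) @ \oo --> r.
  move=> e0; rewrite -[X in _ --> X]mulr1 -[X in r * X](subr0 1) -[X in _ - X](mulr0 a).
  apply: cvgMr; apply: cvgB; first exact: cvg_cst.
  exact: cvgMr.
have cvg_slack r a (l : nat -> R) : l @ \oo --> (0 : R) ->
    (fun k => r + l k + a * (N k)%:R^-1) @ \oo --> r.
  move=> l0; rewrite -[X in _ --> X]addr0 -[X in X + _]addr0 -[X in _ + X](mulr0 a).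
  apply: cvgD; last exact: cvgMr.
  by apply: cvgD => //; exact: cvg_cst.
(* The bound on [R1] has no leakage term; the zero sequence fills its place in [cvg_slack]. *)
have cst0 : (fun=> 0 : R) @ \oo --> (0 : R) by exact: cvg_cst.
split.
- apply: (ler_cvg_to (cvg_err R1 1 _ e1) (cvg_slack m%:R 1 _ cst0)).
  apply: filterS ev => k [N0 h1 h2].
  by have [] := code_rates (c k) mn nm N0 h1 h2; rewrite !mul1r addr0.
- apply: (ler_cvg_to (cvg_err R2 1 _ e2) (cvg_slack (2 * m%:R - n%:R) 1 _ lk)).
  apply: filterS ev => k [N0 h1 h2].
  by have [] := code_rates (c k) mn nm N0 h1 h2; rewrite !mul1r.
- apply: (ler_cvg_to (cvgD (cvg_err R1 2 _ e1) (cvg_err R2 1 _ e2))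
    (cvg_slack (m%:R + C%:R) 3 _ lk)).
  apply: filterS ev => k [N0 h1 h2].
  by have [] := code_rates (c k) mn nm N0 h1 h2; rewrite fctE /= !mul1r.
Unshelve. all: by end_near.
Qed.

Theorem theorem2 (R : realType) (m n C : nat) (m_ge1 : (1 <= m)%N)
    (alpha : R) (alphaE : alpha = n%:R / m%:R)
    (alpha_gt1 : 1 < alpha) (alpha_lt2 : alpha < 2) (R1 R2 : R)
    (R12 : secrecy_capacity_region m n C (R1, R2)) :
  [/\ R1 <= m%:R, R2 <= 2 * m%:R - n%:R & R1 + R2 <= m%:R + C%:R].
Proof.
have m0 : 0 < m%:R :> R by rewrite ltr0n.
have mn : (m <= n)%N.
  by move: alpha_gt1; rewrite alphaE ltr_pdivlMr // mul1r ltr_nat => /ltnW.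
have nm : (n <= m + m)%N.
  move: alpha_lt2; rewrite alphaE ltr_pdivrMr // -natrM ltr_nat mul2n addnn.
  exact: ltnW.
(* A sublevel set of a continuous function is closed, so a bound on all achievable pairs survives
   the closure. *)
have region_le (f : R * R -> R) b : continuous f ->
    (forall r, achievable m n C r -> f r <= b) -> f (R1, R2) <= b.
  move=> fc fb; have cl : closed (f @^-1` [set x | x <= b]).
    by apply: closed_comp => // r _; exact: fc.
  by apply: cl; apply: closureS R12 => r /fb.
have ach r (hr : achievable m n C r) := achievable_rates mn nm hr.
have fst_cont : continuous (@fst R R) by move=> ?; exact: cvg_fst.
have snd_cont : continuous (@snd R R) by move=> ?; exact: cvg_snd.
split.
- by apply: (region_le fst) => // -[r1 r2] /ach[].
- by apply: (region_le snd) => // -[r1 r2] /ach[].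
- apply: (region_le (fun r => r.1 + r.2)) => [r|[r1 r2] /ach[] //].
  by apply: cvgD; [exact: fst_cont|exact: snd_cont].
Qed.
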